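(* Let $\Lambda\subset\mathbb{R}$ be open, $m\ge 2$, and let $\mathcal{M}(2)=[\mathcal{R}_{p,q}]_{1\le p,q\le m}$ with $$\mathcal{R}_{p,p}=f_{p,p,0,1}\mathrm{D}_{0,1}+f_{p,p,1,1}\mathrm{D}_{1,1}+f_{p,p,2,1}\mathrm{D}_{2,1},\qquad \mathcal{R}_{p,q}=f_{p,q,0,1}\mathrm{D}_{0,1}+f_{p,q,1,1}\mathrm{D}_{1,1}\ \ (p\ne q),$$ where $f_{p,q,k,h}\in\mathcal{C}(\Lambda,\mathbb{R})$. A necessary and sufficient condition for $\mathcal{M}(2)$ to be decomposed into the form $\mathcal{M}(2)=\mathcal{N}_1(1)\cdot\mathcal{N}_2(1)$, where for $i=1,2$, $\mathcal{N}_i(1)=[\mathcal{T}_{i,p,q}]_{1\le p,q\le m}$ with $$\mathcal{T}_{i,p,p}=a_{i,p,p,0,1}\mathrm{D}_{0,1}+a_{i,p,p,1,1}\mathrm{D}_{1,1},\qquad \mathcal{T}_{i,p,q}=a_{i,p,q,0,1}\mathrm{D}_{0,1}\ \ (p\ne q),$$ $a_{1,p,q,k,h}\in\mathcal{C}(\Lambda,\mathbb{R})$ and $a_{2,p,q,k,h}\in\mathcal{C}^1(\Lambda,\mathbb{R})$, is that these functions satisfy on $\Lambda$, for all $p\in\{1,\dots,m\}$, \begin{align*} f_{p,p,0,1}&=\sum_{l=1}^m a_{1,p,l,0,1}a_{2,l,p,0,1}+a_{1,p,p,1,1}\mathrm{D}_{1,1}(a_{2,p,p,0,1}),\\ f_{p,p,1,1}&=a_{1,p,p,0,1}a_{2,p,p,1,1}+a_{1,p,p,1,1}a_{2,p,p,0,1}+a_{1,p,p,1,1}\mathrm{D}_{1,1}(a_{2,p,p,1,1}),\\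 f_{p,p,2,1}&=a_{1,p,p,1,1}a_{2,p,p,1,1}, \end{align*} and for all $p\ne q$ in $\{1,\dots,m\}$, \begin{align*} f_{p,q,0,1}&=\sum_{l=1}^m a_{1,p,l,0,1}a_{2,l,q,0,1}+a_{1,p,p,1,1}\mathrm{D}_{1,1}(a_{2,p,q,0,1}),\\ f_{p,q,1,1}&=a_{1,p,p,1,1}a_{2,p,q,0,1}+a_{1,p,q,0,1}a_{2,q,q,1,1}. \end{align*}
   Context: Here $x=x^1\in\Lambda$ is the single independent variable, and $\mathrm{D}_{0,1}w=w$, $\mathrm{D}_{1,1}w=w_x=\frac{dw}{dx}$, $\mathrm{D}_{2,1}w=w_{2x}=\frac{d^2w}{dx^2}$ for scalar functions $w$. A matrix operator acts on $u={}^t(u^1,\dots,u^m)$ by $\mathcal{M}(2)u=\big[\sum_{q=1}^m\mathcal{R}_{p,q}u^q\big]_{1\le p\le m}$ (similarly for $\mathcal{N}_i(1)$), and the product $\mathcal{N}_1(1)\cdot\mathcal{N}_2(1)$ is composition (the right factor acts first). Equality of operators means that both sides give the same result on every $u\in\mathcal{C}^2(\Lambda_0,\mathbb{R}^m)$, for open $\Lambda_0\subset\Lambda$. *)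

(* Defs.v *)
From HB Require Import structures.
From mathcomp Require Import all_boot all_order all_algebra.
From mathcomp Require Import boolp classical_sets functions reals topology.
From mathcomp Require Import normedtype derive.

Set Implicit Arguments.
Unset Strict Implicit.
Unset Printing Implicit Defensive.

Import Order.TTheory GRing.Theory Num.Theory.
Import numFieldTopology.Exports numFieldNormedType.Exports.

Local Open Scope ring_scope.
Local Open Scope classical_set_scope.

(* Functions on an open set A are represented by total functions R -> R of
   which only the values on A matter: since A is open, derivability and the
   derivative at a point of A depend only on the restriction to A. *)
Fixpoint classC (R : realType) (k : nat) (A : set R) (w : R -> R) : Prop :=
  if k is k'.+1
  then (forall x, A x -> derivable w x 1) /\ classC k' A (derive1 w)
  else {within A, continuous w}.

(* An R^m-valued function u = (u^1, ..., u^m) is given by its components. *)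
Definition vfun (R : realType) (m : nat) := 'I_m -> R -> R.

Definition vclassC (R : realType) (m k : nat) (A : set R) (u : vfun R m) :
  Prop := forall q, classC k A (u q).

(* [c p q k] is the coefficient of D_{k,1} in the entry (p, q). *)
Definition coefs (R : realType) (m : nat) := 'I_m -> 'I_m -> nat -> R -> R.

(* The matrix operators considered have entries of order s on the diagonal
   and s - 1 off the diagonal; the values of [c p q k] for k larger than
   [entry_order s p q] play no role. *)
Definition entry_order (m s : nat) (p q : 'I_m) : nat :=
  if p == q then s else s.-1.

Definition coefs_classC (R : realType) (m s k : nat) (A : set R)
    (c : coefs R m) : Prop :=
  forall p q j, (j <= entry_order s p q)%N -> classC k A (c p q j).

Definition scalar_op (R : realType) (n : nat) (c : nat -> R -> R)
    (w : R -> R) : R -> R :=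
  fun x => \sum_(k < n.+1) c k x * derive1n k w x.

Definition matrix_op (R : realType) (m s : nat) (c : coefs R m)
    (u : vfun R m) : vfun R m :=
  fun p x => \sum_(q < m) scalar_op (entry_order s p q) (c p q) (u q) x.

Definition eq_operator (R : realType) (m : nat) (A : set R)
    (M N : vfun R m -> vfun R m) : Prop :=
  forall A0 : set R, open A0 -> A0 `<=` A ->
  forall u : vfun R m, vclassC 2 A0 u ->
  forall p x, A0 x -> M u p x = N u p x.

(* Main.v *)
Require Import Defs.
From HB Require Import structures.
From mathcomp Require Import all_boot all_order all_algebra.
From mathcomp Require Import boolp classical_sets functions reals topology.
From mathcomp Require Import normedtype derive.
From mathcomp Require Import ring.

Set Implicit Arguments.
Unset Strict Implicit.
Unset Printing Implicit Defensive.

Import Order.TTheory GRing.Theory Num.Theory.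
Import numFieldTopology.Exports numFieldNormedType.Exports.

Local Open Scope ring_scope.
Local Open Scope classical_set_scope.

(** Both sides are linear differential operators, so the statement splits into
    two independent facts. First, the composite of the two first-order
    operators is itself an operator of the shape of M(2): the left factor
    differentiates only the p-th component of the right factor's output in its
    p-th row, so the Leibniz rule, which needs the C^1 regularity of the
    right-hand coefficients, yields second derivatives on the diagonal only
    ([matrix_op1_comp]); the coefficients found ([comp_coefs]) are the
    right-hand sides of the system. Second, an operator determines its
    coefficients ([eq_operator_coefsP]): applied to the vector whose only
    nonzero component is the q-th one, equal to (y - x)^k, it has at x the
    p-th component k! times the coefficient of order k in the entry (p, q).
    Thus equality of the operators amounts to equality of the coefficients at
    every point. *)

(** * Test functions *)

Lemma derive1n_horner (R : realType) (P : {poly R}) (k : nat) :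
  derive1n k (horner P) = horner (derivn k P).
Proof.
by elim: k => [//|k IHk]; rewrite derive1nS IHk derivnS derivE.
Qed.

Lemma classC_horner (R : realType) (k : nat) (A : set R) (P : {poly R}) :
  classC k A (horner P).
Proof.
elim: k P => [|k IHk] P /=.
  by apply: continuous_subspaceT; exact: continuous_horner.
by split=> [x _|]; [exact: derivable_horner | rewrite -derivE].
Qed.

Lemma derivn_XsubC_exp (R : realType) (a : R) (n k : nat) :
  derivn k (('X - a%:P) ^+ n) = ('X - a%:P) ^+ (n - k) *+ n ^_ k.
Proof.
elim: k => [|k IHk]; first by rewrite subn0 ffactn0.
rewrite derivnS IHk derivMn deriv_exp derivXsubC mul1r -mulrnA -subnS.
by rewrite mulnC -ffactnSr.
Qed.

(** The Taylor monomial (X - a)^n at a has its only nonzero derivative in order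
    n, so applying an operator to it reads off one single coefficient. *)
Lemma derivn_XsubC_exp_at (R : realType) (a : R) (n k : nat) :
  (derivn k (('X - a%:P) ^+ n)).[a] = (n`!)%:R *+ (k == n).
Proof.
rewrite derivn_XsubC_exp hornerMn horner_exp hornerXsubC subrr expr0n subn_eq0.
case: (ltngtP k n) => [_|ltnk|->].
- by rewrite mul0rn mulr0n.
- by rewrite ffact_small // mulr0n.
- by rewrite ffactnn mulr1n.
Qed.

(** * Uniqueness of the coefficients *)

Lemma scalar_op_Taylor_monomial (R : realType) (n : nat) (c : nat -> R -> R)
    (a : R) (k : nat) :
  (k <= n)%N ->
  scalar_op n c (horner (('X - a%:P) ^+ k)) a = c k a * (k`!)%:R.
Proof.
move=> lekn; rewrite /scalar_op.
under eq_bigr do rewrite derive1n_horner derivn_XsubC_exp_at.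
rewrite (bigD1 (Ordinal (lekn : (k < n.+1)%N))) //= eqxx mulr1n big1 ?addr0 //.
by move=> i; rewrite -val_eqE /= => /negPf ->; rewrite mulr0.
Qed.

(** Feeding a vector with a single nonzero component isolates one entry of the
    matrix. *)
Lemma matrix_op_single (R : realType) (m s : nat) (c : coefs R m) (P : {poly R})
    (p q : 'I_m) (x : R) :
  matrix_op s c (fun r => horner (if r == q then P else 0)) p x =
  scalar_op (entry_order s p q) (c p q) (horner P) x.
Proof.
rewrite /matrix_op (bigD1 q) //= eqxx big1 ?addr0 // => r /negPf ->.
rewrite /scalar_op big1 // => k _.
by rewrite derive1n_horner linear0 horner0 mulr0.
Qed.

(** Coefficients of a matrix operator are determined by its action: only
    polynomial test vectors, which are smooth on every open set, are used, and
    the factor k! they produce is invertible in characteristic 0. *)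
Lemma eq_operator_coefsP (R : realType) (m s : nat) (A : set R)
    (c d : coefs R m) :
  open A ->
  eq_operator A (matrix_op s c) (matrix_op s d) <->
  (forall x, A x -> forall p q k, (k <= entry_order s p q)%N ->
    c p q k x = d p q k x).
Proof.
move=> openA; split=> [eq_cd x Ax p q k lek | eq_cd A0 _ sub u _ p x A0x].
  pose u r := horner (if r == q then ('X - x%:P) ^+ k else 0).
  have uC : vclassC 2 A u by move=> r; exact: classC_horner.
  have /eqP := eq_cd A openA (@subset_refl _ A) u uC p x Ax.
  rewrite !matrix_op_single !scalar_op_Taylor_monomial //.
  by rewrite -subr_eq0 -mulrBl mulf_eq0 pnatr_eq0 eqn0Ngt fact_gt0 orbF subr_eq0
    => /eqP.
apply: eq_bigr => q _; apply: eq_bigr => k _; congr (_ * _).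
by apply: eq_cd; [exact: sub | rewrite -ltnS].
Qed.

(** * Composition of two operators of order one *)

Lemma classC_subset (R : realType) (k : nat) (A B : set R) (w : R -> R) :
  A `<=` B -> classC k B w -> classC k A w.
Proof.
move=> sub; elim: k w => [|k IHk] w /=; first exact: continuous_subspaceW.
by move=> [dw w'C]; split=> [x /sub /dw|]; last exact: IHk.
Qed.

(** Splitting off the highest order, present on the diagonal alone, leaves a
    double sum whose range of orders is the same for all entries. *)
Lemma matrix_op_top_diag (R : realType) (m s : nat) (c : coefs R m)
    (u : vfun R m) (p : 'I_m) (x : R) :
  matrix_op s.+1 c u p x =
  (\sum_(q < m) \sum_(k < s.+1) c p q k x * derive1n k (u q) x)
  + c p p s.+1 x * derive1n s.+1 (u p) x.
Proof.
rewrite /matrix_op (bigD1 p) //= [in RHS](bigD1 p) //= addrAC.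
rewrite /scalar_op /entry_order eqxx big_ord_recr /=; congr (_ + _).
by apply: eq_bigr => q; rewrite eq_sym => /negPf ->.
Qed.

Lemma matrix_op1E (R : realType) (m : nat) (c : coefs R m) (u : vfun R m)
    (p : 'I_m) (x : R) :
  matrix_op 1 c u p x =
  \sum_(q < m) c p q 0%N x * u q x + c p p 1%N x * derive1 (u p) x.
Proof.
rewrite matrix_op_top_diag; congr (_ + _).
by apply: eq_bigr => q _; rewrite big_ord1.
Qed.

Lemma matrix_op2E (R : realType) (m : nat) (c : coefs R m) (u : vfun R m)
    (p : 'I_m) (x : R) :
  matrix_op 2 c u p x =
  \sum_(q < m) (c p q 0%N x * u q x + c p q 1%N x * derive1 (u q) x)
  + c p p 2%N x * derive1 (derive1 (u p)) x.
Proof.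
rewrite matrix_op_top_diag; congr (_ + _).
by apply: eq_bigr => q _; rewrite big_ord_recr big_ord1.
Qed.

Definition comp_coefs (R : realType) (m : nat) (a b : coefs R m) : coefs R m :=
  fun p q k x => match k with
  | 0 => \sum_(l < m) a p l 0%N x * b l q 0%N x
         + a p p 1%N x * derive1 (b p q 0%N) x
  | 1 => a p p 1%N x * b p q 0%N x + a p q 0%N x * b q q 1%N x
         + (a p p 1%N x * derive1 (b p p 1%N) x) *+ (p == q)
  | _ => a p p 1%N x * b p p 1%N x
  end.

Lemma derive1_matrix_op1 (R : realType) (m : nat) (A : set R) (b : coefs R m)
    (u : vfun R m) (p : 'I_m) (x : R) :
  coefs_classC 1 1 A b -> vclassC 2 A u -> A x ->
  derive1 (matrix_op 1 b u p) x =
  \sum_(q < m) (b p q 0%N x * derive1 (u q) x + derive1 (b p q 0%N) x * u q x)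
  + (b p p 1%N x * derive1 (derive1 (u p)) x
     + derive1 (b p p 1%N) x * derive1 (u p) x).
Proof.
move=> bC uC Ax.
have db q k : (k <= entry_order 1 p q)%N ->
    is_derive x 1 (b p q k) (derive1 (b p q k) x).
  by move=> lek; rewrite derive1E; apply: derivableP; apply: (bC _ _ _ lek).1.
have du q : is_derive x 1 (u q) (derive1 (u q) x).
  by rewrite derive1E; apply: derivableP; apply: (uC q).1.
have ddu : is_derive x 1 (derive1 (u p)) (derive1 (derive1 (u p)) x).
  by rewrite [X in is_derive _ _ _ X]derive1E; apply: derivableP;
    apply: (uC p).2.1.
have -> : matrix_op 1 b u p =
    \sum_(q < m) (b p q 0%N * u q) + b p p 1%N * derive1 (u p).
  by apply/funext => y; rewrite matrix_op1E fctE fct_sumE.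
have db1 : is_derive x 1 (b p p 1%N) (derive1 (b p p 1%N) x).
  by apply: db; rewrite /entry_order eqxx.
have db0 q := db q 0%N (leq0n _).
rewrite derive1E; apply: derive_val; apply: is_derive_eq.
by congr (_ + _); [apply: eq_bigr => q _|]; congr (_ + _); exact: mulrC.
Qed.

(** The Leibniz rule applied to the right factor; collecting the terms in u, u'
    and u'' gives an operator of the same shape as M(2), because the only
    derivative taken by the left factor is on the diagonal. *)
Lemma matrix_op1_comp (R : realType) (m : nat) (A : set R) (a b : coefs R m)
    (u : vfun R m) (p : 'I_m) (x : R) :
  coefs_classC 1 1 A b -> vclassC 2 A u -> A x ->
  matrix_op 1 a (matrix_op 1 b u) p x = matrix_op 2 (comp_coefs a b) u p x.
Proof.
move=> bC uC Ax.
rewrite matrix_op1E (derive1_matrix_op1 _ bC uC Ax) matrix_op2E /=.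
under eq_bigr do rewrite matrix_op1E mulrDr mulr_sumr.
rewrite big_split /= exchange_big /= !mulrDr mulr_sumr.
(* The derivative of the leading coefficient of b contributes a first-order
   term at q = p only, hence the Kronecker factor in the coefficients. *)
have -> : a p p 1%N x * (derive1 (b p p 1%N) x * derive1 (u p) x) =
    \sum_(q < m) (a p p 1%N x * derive1 (b p p 1%N) x) *+ (p == q)
                 * derive1 (u q) x.
  rewrite (bigD1 p) //= eqxx mulr1n mulrA big1 ?addr0 // => q.
  by rewrite eq_sym => /negPf ->; rewrite mul0r.
rewrite [X in _ + (_ + X) = _]addrC !addrA mulrA; congr (_ + _).
rewrite -!big_split /=; apply: eq_bigr => q _.
under eq_bigr do rewrite mulrA.
by rewrite -mulr_suml; ring.
Qed.

Theorem proposition2p5 (R : realType) (Lambda : set R) (m : nat)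
    (f a1 a2 : coefs R m) :
  open Lambda -> (2 <= m)%N ->
  coefs_classC 2 0 Lambda f ->
  coefs_classC 1 0 Lambda a1 ->
  coefs_classC 1 1 Lambda a2 ->
  eq_operator Lambda (matrix_op 2 f) (matrix_op 1 a1 \o matrix_op 1 a2) <->
  (forall x, Lambda x ->
    (forall p : 'I_m,
      [/\ f p p 0%N x = \sum_(l < m) a1 p l 0%N x * a2 l p 0%N x
                      + a1 p p 1%N x * derive1 (a2 p p 0%N) x,
          f p p 1%N x = a1 p p 0%N x * a2 p p 1%N x + a1 p p 1%N x * a2 p p 0%N x
                      + a1 p p 1%N x * derive1 (a2 p p 1%N) x
        & f p p 2%N x = a1 p p 1%N x * a2 p p 1%N x]) /\
    (forall p q : 'I_m, p != q ->
      f p q 0%N x = \sum_(l < m) a1 p l 0%N x * a2 l q 0%N x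
                  + a1 p p 1%N x * derive1 (a2 p q 0%N) x /\
      f p q 1%N x = a1 p p 1%N x * a2 p q 0%N x + a1 p q 0%N x * a2 q q 1%N x)).
Proof.
move=> openL _ _ _ a2C.
have compE : eq_operator Lambda (matrix_op 1 a1 \o matrix_op 1 a2)
    (matrix_op 2 (comp_coefs a1 a2)).
  move=> A0 _ sub u uC p x A0x /=.
  apply: (matrix_op1_comp (A := A0)) => //.
  by move=> r q j lej; have := a2C r q j lej; exact: classC_subset.
have -> : eq_operator Lambda (matrix_op 2 f) (matrix_op 1 a1 \o matrix_op 1 a2)
    <-> eq_operator Lambda (matrix_op 2 f) (matrix_op 2 (comp_coefs a1 a2)).
  split=> E A0 oA sub u uC p x A0x;
    by rewrite (E A0 oA sub u uC p x A0x) (compE A0 oA sub u uC p x A0x).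
rewrite eq_operator_coefsP //; split=> E x Lx.
  split=> [p|p q npq].
    have Ep k : (k <= 2)%N -> f p p k x = comp_coefs a1 a2 p p k x.
      by move=> lek; apply: E => //; rewrite /entry_order eqxx.
    split; first exact: Ep.
      by rewrite Ep //= eqxx mulr1n; ring.
    exact: Ep.
  have Epq k : (k <= 1)%N -> f p q k x = comp_coefs a1 a2 p q k x.
    by move=> lek; apply: E => //; rewrite /entry_order (negPf npq).
  split; first exact: Epq.
  by rewrite Epq //= (negPf npq) mulr0n addr0.
move=> p q k; have [diagE offE] := E x Lx.
rewrite /entry_order; case: eqVneq => [<-|npq].
  have [E0 E1 E2] := diagE p.
  case: k => [|[|[|//]]] _ //=.
  by rewrite E1 eqxx mulr1n; ring.
have [E0 E1] := offE p q npq.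
by case: k => [|[|//]] _ //=; rewrite E1 (negPf npq) mulr0n addr0.
Qed.
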